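(* Let $A\in\mathbb R_+^{m\times n}$ be a nonnegative matrix. Then the following hold. 1. (Invariance under diagonal scaling) If $D_1\in\mathbb R^{m\times m}$ and $D_2\in\mathbb R^{n\times n}$ are diagonal matrices with strictly positive entries on the diagonal, then $\tau_+(D_1AD_2)=\tau_+(A)$ and $\tau_+^{\mathrm{sos}}(D_1AD_2)=\tau_+^{\mathrm{sos}}(A)$. 2. (Invariance under permutation of rows or columns) If $P_1$ and $P_2$ are permutation matrices of size $m\times m$ and $n\times n$ respectively, then $\tau_+(P_1AP_2)=\tau_+(A)$ and $\tau_+^{\mathrm{sos}}(P_1AP_2)=\tau_+^{\mathrm{sos}}(A)$. 3. (Subadditivity) If $B\in\mathbb R_+^{m\times n}$, then $\tau_+(A+B)\le\tau_+(A)+\tau_+(B)$ and $\tau_+^{\mathrm{sos}}(A+B)\le\tau_+^{\mathrm{sos}}(A)+\tau_+^{\mathrm{sos}}(B)$. 4. (Product) If $B\in\mathbb R_+^{n\times p}$, then $\tau_+(AB)\le\min(\tau_+(A),\tau_+(B))$ and $\tau_+^{\mathrm{sos}}(AB)\le\min(\tau_+^{\mathrm{sos}}(A),\tau_+^{\mathrm{sos}}(B))$. 5. (Monotonicity) If $B$ is a submatrix of $A$ (i.e. $B=A[I,J]$ for some $I\subseteq\{1,\dots,m\}$, $J\subseteq\{1,\dots,n\}$), then $\tau_+(B)\le\tau_+(A)$ and $\tau_+^{\mathrm{sos}}(B)\le\tau_+^{\mathrm{sos}}(A)$. 6. (Block-diagonal composition) If $B\in\mathbb R_+^{m'\times n'}$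 and $A\oplus B=\begin{bmatrix}A&0\\0&B\end{bmatrix}$, then $\tau_+(A\oplus B)=\tau_+(A)+\tau_+(B)$ and $\tau_+^{\mathrm{sos}}(A\oplus B)=\tau_+^{\mathrm{sos}}(A)+\tau_+^{\mathrm{sos}}(B)$.
   Context: $\mathbb R_+^{m\times n}$ is the set of entrywise nonnegative real $m\times n$ matrices; $\le$ between matrices is entrywise. For $A\in\mathbb R_+^{m\times n}$ define $$\mathcal A_+(A)=\{R\in\mathbb R^{m\times n}: \operatorname{rank}R\le 1,\ 0\le R\le A\},$$ $$\tau_+(A)=\max\{L(A): L \text{ a linear functional on }\mathbb R^{m\times n},\ L(R)\le 1\ \ \forall R\in\mathcal A_+(A)\}.$$ $\operatorname{vec}(A)\in\mathbb R^{mn}$ is the vector obtained by stacking the columns of $A$; coordinates of $\mathbb R^{mn}$, and rows and columns of a real symmetric $mn\times mn$ matrix $X$, are indexed by pairs $ij$ with $1\le i\le m$, $1\le j\le n$ (so that $\operatorname{vec}(A)_{ij}=A_{ij}$). The quantity $\tau_+^{\mathrm{sos}}(A)$ is the optimal value of the semidefinite program: minimize $t$ over $t\in\mathbb R$ and real symmetric $mn\times mn$ matrices $X$ subject to $$\begin{bmatrix}t&\operatorname{vec}(A)^T\\ \operatorname{vec}(A)&X\end{bmatrix}\succeq 0,\qquad X_{ij,ij}\le A_{ij}^2\ \ \forall i,j,\qquad X_{ij,kl}=X_{il,kj}\ \ \text{for all } 1\le i<k\le m,\ 1\le j<l\le n,$$ where $\succeq 0$ means positive semidefinite. *)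

(* Defs.v *)
From HB Require Import structures.
From mathcomp Require Import all_boot all_order all_algebra.
From mathcomp Require Import all_classical all_reals all_analysis.

Set Implicit Arguments.
Unset Strict Implicit.
Unset Printing Implicit Defensive.

Import Order.TTheory GRing.Theory Num.Theory.
Import numFieldNormedType.Exports.

Local Open Scope classical_set_scope.
Local Open Scope ring_scope.

Section Definitions.
Variable R : realType.

Definition mxle m n (A B : 'M[R]_(m, n)) : Prop := forall i j, A i j <= B i j.

(** Rows in [I] and columns in [J], both listed in increasing order. *)
Definition submatrix m n (A : 'M[R]_(m, n)) (I : {set 'I_m}) (J : {set 'I_n}) :
    'M[R]_(#|I|, #|J|) :=
  \matrix_(i, j) A (enum_val i) (enum_val j).

Definition atoms m n (A : 'M[R]_(m, n)) : set 'M[R]_(m, n) :=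
  [set S | [/\ (\rank S <= 1)%N, mxle 0 S & mxle S A]].

Definition tau_values m n (A : 'M[R]_(m, n)) : set R :=
  [set z | exists L : {scalar 'M[R]_(m, n)},
     (forall S, atoms A S -> L S <= 1) /\ z = L A].

(** For [A >= 0] this supremum is a maximum: see [tau_plus_attained] and
    [tau_plus_ub]. *)
Definition tau_plus m n (A : 'M[R]_(m, n)) : R := sup (tau_values A).

Definition psdmx N (M : 'M[R]_N) : Prop :=
  M^T = M /\ forall x : 'cV[R]_N, 0 <= (x^T *m M *m x) 0 0.

(** [mxvec] concatenates rows, so stacking the columns of [A] is [mxvec] of
    the transpose. *)
Definition vec m n (A : 'M[R]_(m, n)) : 'cV[R]_(n * m) := (mxvec A^T)^T.

(** The position of the pair [ij] in that stacking. *)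
Definition vidx m n (i : 'I_m) (j : 'I_n) : 'I_(n * m) := mxvec_index j i.

Lemma vecE m n (A : 'M[R]_(m, n)) i j : vec A (vidx i j) 0 = A i j.
Proof. by rewrite /vec /vidx mxE mxvecE mxE. Qed.

Definition sos_feasible m n (A : 'M[R]_(m, n)) (t : R) (X : 'M[R]_(n * m)) :
    Prop :=
  [/\ X^T = X,
      psdmx (block_mx (t%:M : 'M[R]_1) (vec A)^T (vec A) X),
      forall (i : 'I_m) (j : 'I_n), X (vidx i j) (vidx i j) <= A i j ^+ 2
    & forall (i k : 'I_m) (j l : 'I_n), (i < k)%N -> (j < l)%N ->
        X (vidx i j) (vidx k l) = X (vidx i l) (vidx k j)].

Definition sos_values m n (A : 'M[R]_(m, n)) : set R :=
  [set t | exists X, sos_feasible A t X].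

(** The program is feasible and bounded below: see [sos_values_has_inf]. *)
Definition tau_sos m n (A : 'M[R]_(m, n)) : R := inf (sos_values A).

End Definitions.

Section WellDefined.
Variable R : realType.
Implicit Types m n : nat.

Lemma scalar_mxE m n (L : {scalar 'M[R]_(m, n)}) S :
  L S = \sum_i \sum_j S i j * L (delta_mx i j).
Proof.
rewrite {1}(matrix_sum_delta S) linear_sum; apply: eq_bigr => i _.
rewrite linear_sum; apply: eq_bigr => j _; exact: linearZ.
Qed.

Lemma atoms_delta m n (A : 'M[R]_(m, n)) i j :
  mxle 0 A -> atoms A (A i j *: delta_mx i j).
Proof.
move=> A0; split.
- by rewrite (leq_trans (mxrank_scale _ _)) // mxrank_delta.
- by move=> k l; rewrite !mxE; apply: mulr_ge0 => //; have := A0 i j; rewrite mxE.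
- move=> k l; rewrite !mxE; case: eqP => [->|_] /=; last first.
    by rewrite mulr0; have := A0 k l; rewrite mxE.
  case: eqP => [->|_]; first by rewrite mulr1.
  by rewrite mulr0; have := A0 i l; rewrite mxE.
Qed.

Lemma atom_term_le1 m n (A : 'M[R]_(m, n)) (L : {scalar 'M[R]_(m, n)}) i j :
  mxle 0 A -> (forall S, atoms A S -> L S <= 1) ->
  A i j * L (delta_mx i j) <= 1.
Proof. by move=> A0 LA; rewrite -linearZ LA //; exact: atoms_delta. Qed.

Lemma tau_values_has_sup m n (A : 'M[R]_(m, n)) :
  mxle 0 A -> has_sup (tau_values A).
Proof.
move=> A0; split.
  by exists 0; exists \0%R; split => // S _ /=; exact: ler01.
exists (\sum_(i < m) \sum_(j < n) 1) => _ [L [LA ->]].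
rewrite scalar_mxE; apply: ler_sum => i _; apply: ler_sum => j _.
exact: atom_term_le1.
Qed.

Lemma tau_plus_ub m n (A : 'M[R]_(m, n)) (L : {scalar 'M[R]_(m, n)}) :
  mxle 0 A -> (forall S, atoms A S -> L S <= 1) -> L A <= tau_plus A.
Proof.
move=> A0 LA; apply: sup_upper_bound; first exact: tau_values_has_sup.
by exists L.
Qed.

Let wform m n (W S : 'M[R]_(m, n)) : R := \sum_i \sum_j W i j * S i j.

Let wform_scalar m n (W : 'M[R]_(m, n)) : scalar (wform W).
Proof.
move=> a S T; rewrite /wform mulr_sumr -big_split; apply: eq_bigr => i _ /=.
rewrite mulr_sumr -big_split; apply: eq_bigr => j _ /=.
by rewrite !mxE mulrDr mulrCA.
Qed.

Let wform_continuous m n (S : 'M[R]_(m, n)) :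
  continuous (fun v : 'rV[R]_(m * n) => wform (vec_mx v) S).
Proof.
have sum_continuous (I : Type) (r : seq I) (F : I -> 'rV[R]_(m * n) -> R) :
    (forall i, continuous (F i)) -> continuous (fun v => \sum_(i <- r) F i v).
  move=> cF; elim: r => [|i r IH].
    rewrite (_ : (fun v => _) = fun=> 0); first exact: cst_continuous.
    by apply/funext => v; rewrite big_nil.
  rewrite (_ : (fun v => _) = (fun v => F i v + \sum_(k <- r) F k v)).
    by move=> v; exact: cvgD (cF i v) (IH v).
  by apply/funext => v; rewrite big_cons.
apply: (sum_continuous) => i; apply: (sum_continuous) => j v.
rewrite (_ : (fun v => _) = (fun v : 'rV[R]_(m * n) => v 0 (mxvec_index i j) * S i j)).
  have cv := @coord_continuous R 1 (m * n) 0 (mxvec_index i j) v.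
  exact: cvgM cv (cvg_cst (S i j)).
by apply/funext => u; rewrite mxE.
Qed.

Lemma tau_plus_attained m n (A : 'M[R]_(m, n)) : mxle 0 A ->
  exists L : {scalar 'M[R]_(m, n)},
    (forall S, atoms A S -> L S <= 1) /\ L A = tau_plus A.
Proof.
move=> A0; have A0' i j : 0 <= A i j by have := A0 i j; rewrite mxE.
pose N : R := \sum_(i < m) \sum_(j < n) 1.
have N0 : 0 <= N by apply: sumr_ge0 => i _; apply: sumr_ge0.
pose a : 'rV[R]_(m * n) := mxvec A.
pose K : set 'rV[R]_(m * n) :=
  [set v : 'rV[R]_(m * n) |
      forall k, `[- (N / a 0 k), (a 0 k)^-1]%classic (v 0 k)] `&`
  \bigcap_(S in atoms A) [set v : 'rV[R]_(m * n) | wform (vec_mx v) S <= 1].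
have a0 k : 0 <= a 0 k by case/mxvec_indexP: k => i j; rewrite mxvecE.
have K0 : K 0.
  split=> [k|S _] /=.
    by rewrite mxE in_itv /= oppr_le0 invr_ge0 a0 divr_ge0.
  rewrite /wform big1 ?ler01 // => i _; rewrite big1 // => j _.
  by rewrite linear0 mxE mul0r.
have cK : compact K.
  apply: compact_closedI.
    apply: (@rV_compact R (m * n)
      (fun k => `[- (N / a 0 k), (a 0 k)^-1]%classic)) => k.
    exact: segment_compact.
  apply: closed_bigI => S _.
  apply: (@preimage_closed _ _ (fun v => wform (vec_mx v) S) [set x | x <= 1]).
    by move=> v _; exact: wform_continuous.
  exact: closed_le.
have [|v /set_mem [_ Kv] vmax] := @compact_EVT_max _ _
    (fun v => wform (vec_mx v) A) K (ex_intro _ _ K0) cK.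
  by apply: continuous_subspaceT => v; exact: wform_continuous.
pose Lv : {scalar 'M[R]_(m, n)} :=
  HB.pack (wform (vec_mx v)) (GRing.isLinear.Build _ _ _ _ _ (wform_scalar (vec_mx v))).
have LvA S : atoms A S -> Lv S <= 1 by exact: Kv.
exists Lv; split=> //; apply/eqP; rewrite eq_le tau_plus_ub //=.
apply: ge_sup => [|_ [L [LA ->]]]; first by case: (tau_values_has_sup A0).
have [LA0|LA0] := leP (L A) 0.
  apply: le_trans LA0 _; apply: le_trans (vmax 0 (mem_set K0)).
  by rewrite /wform sumr_ge0 // => i _; rewrite sumr_ge0 // => j _; rewrite linear0 mxE mul0r.
pose w : 'rV[R]_(m * n) := mxvec (\matrix_(i, j)
  if A i j == 0 then 0 else L (delta_mx i j)).
have wE S : atoms A S -> wform (vec_mx w) S = L S.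
  move=> [_ S0 SA]; rewrite scalar_mxE; apply: eq_bigr => i _.
  apply: eq_bigr => j _; rewrite mxvecK mxE mulrC; case: eqP => // Aij.
  suff -> : S i j = 0 by rewrite !mul0r.
  apply/eqP; rewrite eq_le -{1}Aij SA.
  by have := S0 i j; rewrite mxE.
have wA : wform (vec_mx w) A = L A.
  rewrite scalar_mxE; apply: eq_bigr => i _; apply: eq_bigr => j _.
  by rewrite mxvecK mxE mulrC; case: eqP => // ->; rewrite !mul0r.
rewrite -wA; apply: vmax; apply: mem_set; split; last first.
  by move=> S SA /=; rewrite wE ?LA.
move=> k; case/mxvec_indexP: k => i j /=.
rewrite in_itv /= !mxvecE mxE; case: eqP => [->|/eqP Aij].
  by rewrite invr0 mulr0 oppr0 lexx.
have Ap : 0 < A i j by rewrite lt_def Aij A0'.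
apply/andP; split; last first.
  by rewrite -[leRHS]mul1r ler_pdivlMr // mulrC atom_term_le1.
rewrite -mulNr ler_pdivrMr //.
have : 0 <= N + A i j * L (delta_mx i j); last first.
  by rewrite mulrC -lerBlDl sub0r.
apply: le_trans (ltW LA0) _; rewrite scalar_mxE /N.
rewrite !pair_bigA /= (bigD1 (i, j)) //= addrC.
rewrite [X in _ <= X + _](bigD1 (i, j)) //= lerD2r.
rewrite -[leLHS]add0r lerD //; apply: ler_sum => p _; exact: atom_term_le1.
Qed.

Lemma sos_values_has_inf m n (A : 'M[R]_(m, n)) : has_inf (sos_values A).
Proof.
split; last first.
  exists 0 => t [X [_ [_ psd] _ _]].
  have := psd (delta_mx (lshift _ 0) 0).
  by rewrite trmx_delta -rowE -colE mxE [X in _ <= X]mxE block_mxEul mxE eqxx.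
pose a : 'rV[R]_(n * m) := (vec A)^T.
pose B : 'M[R]_(n * m, 1 + n * m) := row_mx (const_mx 1) (diag_mx a).
exists (n * m)%:R, ((diag_mx a)^T *m diag_mx a).
have vidx_inj (i k : 'I_m) (j l : 'I_n) : vidx i j = vidx k l -> i = k.
  move=> E; have := vecE (\matrix_(p < m, q < n) (p == i)%:R : 'M[R]_(m, n)) i j.
  rewrite E vecE !mxE eqxx; have [//|_ /eqP] := eqVneq k i.
  by rewrite eq_sym oner_eq0.
have XE k l : ((diag_mx a)^T *m diag_mx a) k l = (a 0 k ^+ 2) *+ (k == l).
  by rewrite tr_diag_mx mul_diag_mx !mxE mulrnAr; case: eqP => [->|].
have ME : block_mx ((n * m)%:R%:M : 'M[R]_1) (vec A)^T (vec A)
    ((diag_mx a)^T *m diag_mx a) = B^T *m B.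
  rewrite tr_row_mx mul_col_row; congr block_mx.
  - apply/matrixP => i j; rewrite !ord1 !mxE eqxx mulr1n.
    under eq_bigr do rewrite !mxE mulr1.
    by rewrite sumr_const card_ord.
  - apply/matrixP => i j; rewrite !ord1 mul_mx_diag !mxE mul1r //.
  - apply/matrixP => i j; rewrite !ord1 tr_diag_mx mul_diag_mx !mxE mulr1 //.
split.
- by rewrite trmx_mul trmxK.
- rewrite ME; split; first by rewrite trmx_mul trmxK.
  move=> x; rewrite mulmxA -trmx_mul -mulmxA mxE sumr_ge0 // => k _.
  by rewrite mxE -expr2 sqr_ge0.
- by move=> i j; rewrite XE eqxx mulr1n mxE vecE.
- move=> i k j l ik jl; rewrite !XE.
  have ik' : i <> k by move=> E; rewrite E ltnn in ik.
  by do 2![case: eqP => [/vidx_inj //|_]].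
Qed.

End WellDefined.

(* Main.v *)
(** Both quantities can only decrease under [A |-> P A Q] with [P, Q >= 0]:
    functionals pull back along [S |-> P S Q], and a solution [X] of the
    semidefinite program, read as a bilinear form on matrices, pulls back
    along [W |-> P^T W Q^T]; the diagonal constraint survives because the
    Cauchy-Schwarz inequality gives [X (V, W) <= <A, V> <A, W>] for
    nonnegative [V] and [W].  Scaling, permutation, product, submatrix and the
    upper bound for direct sums are instances of this and of subadditivity.
    For the lower bound on a direct sum, an atom cannot meet both diagonal
    blocks; likewise the two blocks are orthogonal for [X], by the exchange
    constraint and because null vectors of a positive form are in its radical.
    Then [t >= - 2 <A, V> - X (V, V) - 2 <B, W> - X (W, W)] for all [V], [W],
    and taking the supremum over [V] splits [t] between the two blocks. *)

From HB Require Import structures.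
Require Import Defs.
From mathcomp Require Import all_boot all_order fingroup perm all_algebra.
From mathcomp Require Import all_classical all_reals all_analysis.
From mathcomp Require Import ring lra.

Set Implicit Arguments.
Unset Strict Implicit.
Unset Printing Implicit Defensive.

Import Order.TTheory GRing.Theory Num.Theory.

Local Open Scope ring_scope.

(** * Entrywise nonnegative matrices *)

Section NonnegativeMatrices.
Variable R : realType.

Lemma mxle0P m n (A : 'M[R]_(m, n)) : mxle 0 A <-> forall i j, 0 <= A i j.
Proof. by split=> A0 i j; have := A0 i j; rewrite mxE. Qed.

Lemma mxle0_tr m n (A : 'M[R]_(m, n)) : mxle 0 A -> mxle 0 A^T.
Proof. by move=> /mxle0P A0; apply/mxle0P => i j; rewrite mxE. Qed.

Lemma mxle0_1 p : mxle 0 (1%:M : 'M[R]_p).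
Proof. by apply/mxle0P => i j; rewrite mxE ler0n. Qed.

Lemma mulmx_ge0 m n p (A : 'M[R]_(m, n)) (B : 'M[R]_(n, p)) :
  mxle 0 A -> mxle 0 B -> mxle 0 (A *m B).
Proof.
move=> /mxle0P A0 /mxle0P B0; apply/mxle0P => i j; rewrite mxE sumr_ge0 // => k _.
by rewrite mulr_ge0.
Qed.

Lemma mxle_mul2l m n p (P : 'M[R]_(m, n)) (A B : 'M[R]_(n, p)) :
  mxle 0 P -> mxle A B -> mxle (P *m A) (P *m B).
Proof.
move=> /mxle0P P0 AB i j; rewrite !mxE ler_sum // => k _.
by rewrite ler_wpM2l.
Qed.

Lemma mxle_mul2r m n p (A B : 'M[R]_(m, n)) (Q : 'M[R]_(n, p)) :
  mxle 0 Q -> mxle A B -> mxle (A *m Q) (B *m Q).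
Proof.
move=> /mxle0P Q0 AB i j; rewrite !mxE ler_sum // => k _.
by rewrite ler_wpM2r.
Qed.

Lemma perm_mx_ge0 p (s : 'S_p) : mxle 0 (perm_mx s : 'M[R]_p).
Proof. by apply/mxle0P => i j; rewrite !mxE ler0n. Qed.

(** The nonnegativity of the inverse is what matters: it lets a diagonal scaling be undone by a map
    of the same monotone kind. *)
Lemma diag_mx_pos_inv p (D : 'M[R]_p) : is_diag_mx D -> (forall i, 0 < D i i) ->
  mxle 0 D /\ exists2 D', mxle 0 D' & D' *m D = 1%:M /\ D *m D' = 1%:M.
Proof.
move=> /diag_mxP[d ->] D0.
have d0 i : 0 < d 0 i by have := D0 i; rewrite mxE eqxx.
have diag0 (e : 'rV[R]_p) : (forall i, 0 <= e 0 i) -> mxle 0 (diag_mx e).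
  by move=> e0; apply/mxle0P => i j; rewrite mxE mulrn_wge0.
split; first by apply: diag0 => i; exact: ltW.
exists (diag_mx (\row_i (d 0 i)^-1)).
  by apply: diag0 => i; rewrite mxE invr_ge0 ltW.
split; rewrite mul_diag_mx; apply/matrixP => i j; rewrite !mxE;
  case: eqP => [->|_]; rewrite ?mulr1n ?mulr0n ?mulr0 //.
  by rewrite mulVf ?gt_eqF.
by rewrite mulfV ?gt_eqF.
Qed.

End NonnegativeMatrices.

(** * Functionals bounded on atoms: two-sided products, sums and minors *)

Section TauPlus.
Variable R : realType.

Lemma atoms_mul m n m' n' (P : 'M[R]_(m', m)) (A S : 'M[R]_(m, n))
    (Q : 'M[R]_(n, n')) :
  mxle 0 P -> mxle 0 Q -> atoms A S -> atoms (P *m A *m Q) (P *m S *m Q).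
Proof.
move=> P0 Q0 [rS S0 SA]; split.
- by apply: leq_trans rS; apply: leq_trans (mxrankM_maxl _ _) (mxrankM_maxr _ _).
- by do 2?apply: mulmx_ge0.
- by apply: mxle_mul2r => //; apply: mxle_mul2l.
Qed.

Lemma mul2mx_is_scalar m n m' n' (P : 'M[R]_(m', m)) (Q : 'M[R]_(n, n'))
    (L : {scalar 'M[R]_(m', n')}) :
  scalar (fun S : 'M[R]_(m, n) => L (P *m S *m Q)).
Proof. by move=> a S T; rewrite mulmxDr mulmxDl -scalemxAr -scalemxAl linearP. Qed.

Definition pullback m n m' n' (P : 'M[R]_(m', m)) (Q : 'M[R]_(n, n'))
    (L : {scalar 'M[R]_(m', n')}) : {scalar 'M[R]_(m, n)} :=
  HB.pack (fun S => L (P *m S *m Q))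
    (GRing.isLinear.Build _ _ _ _ _ (mul2mx_is_scalar P Q L)).

Lemma tau_plus_le m n (A : 'M[R]_(m, n)) c : mxle 0 A ->
  (forall L : {scalar 'M[R]_(m, n)}, (forall S, atoms A S -> L S <= 1) ->
     L A <= c) ->
  tau_plus A <= c.
Proof. by move=> /tau_plus_attained[L [LA <-]]; apply. Qed.

Lemma tau_plus_mul m n m' n' (P : 'M[R]_(m', m)) (A : 'M[R]_(m, n))
    (Q : 'M[R]_(n, n')) :
  mxle 0 P -> mxle 0 A -> mxle 0 Q -> tau_plus (P *m A *m Q) <= tau_plus A.
Proof.
move=> P0 A0 Q0; apply: tau_plus_le => [|L LA]; first by do 2?apply: mulmx_ge0.
apply: (tau_plus_ub (L := pullback P Q L)) => // S SA.
by apply: LA; apply: atoms_mul.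
Qed.

(** Atoms of [A] and atoms of [B] are atoms of [A + B], so a functional admissible for the sum is
    admissible for each summand. *)
Lemma tau_plus_add m n (A B : 'M[R]_(m, n)) :
  mxle 0 A -> mxle 0 B -> tau_plus (A + B) <= tau_plus A + tau_plus B.
Proof.
move=> A0 B0; have /mxle0P A0' := A0; have /mxle0P B0' := B0.
apply: tau_plus_le => [|L LAB]; first by apply/mxle0P => i j; rewrite mxE addr_ge0.
rewrite linearD lerD //; apply: tau_plus_ub => // S [rS S0 SA];
  apply: LAB; split=> // i j; rewrite mxE; apply: le_trans (SA i j) _.
  by rewrite lerDl.
by rewrite lerDr.
Qed.

(** Factor [S] as [col_base S *m row_base S]; the inner dimension is 0 or 1, so each entry is zero
    or a single product. *)
Lemma rank_le1_minor (m n : nat) (S : 'M[R]_(m, n)) (i k : 'I_m) (j l : 'I_n) :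
  (\rank S <= 1)%N -> S i j * S k l = S i l * S k j.
Proof.
move=> rS; rewrite -(mulmx_base S).
case: (\rank S) (col_base S) (row_base S) rS => [|[|//]] u v _.
  by rewrite !mxE !big_ord0 !mul0r.
by rewrite !mxE !big_ord1; ring.
Qed.

End TauPlus.

(** * The semidefinite program in terms of bilinear forms on matrices *)

Section TauSos.
Variable R : realType.

Definition bil m n (X : 'M[R]_(n * m)) (V W : 'M[R]_(m, n)) : R :=
  ((vec V)^T *m X *m vec W) 0 0.

Definition dot m n (V W : 'M[R]_(m, n)) : R := \tr (V^T *m W).

Lemma vecD m n (V W : 'M[R]_(m, n)) : vec (V + W) = vec V + vec W.
Proof. by rewrite /vec !linearD. Qed.

Lemma vecZ m n c (V : 'M[R]_(m, n)) : vec (c *: V) = c *: vec V.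
Proof. by rewrite /vec !linearZ. Qed.

Lemma vec_delta m n (i : 'I_m) (j : 'I_n) :
  vec (delta_mx i j : 'M[R]_(m, n)) = delta_mx (vidx i j) 0.
Proof. by rewrite /vec trmx_delta mxvec_delta trmx_delta. Qed.

Lemma vec_surj m n (v : 'cV[R]_(n * m)) : exists W : 'M[R]_(m, n), v = vec W.
Proof. by exists (vec_mx v^T)^T; rewrite /vec trmxK vec_mxK trmxK. Qed.

Lemma sum_vidx m n (F : 'I_(n * m) -> R) :
  \sum_p F p = \sum_(i < m) \sum_(j < n) F (vidx i j).
Proof.
rewrite exchange_big pair_bigA (reindex _ (curry_mxvec_bij _ _)) /=.
by apply: eq_bigr => -[j i] _.
Qed.

Lemma dotE m n (V W : 'M[R]_(m, n)) :
  dot V W = \sum_i \sum_j V i j * W i j.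
Proof.
rewrite /dot /mxtrace exchange_big; apply: eq_bigr => j _.
by rewrite mxE; apply: eq_bigr => i _; rewrite mxE.
Qed.

Lemma vec_dot m n (V W : 'M[R]_(m, n)) : ((vec V)^T *m vec W) 0 0 = dot V W.
Proof.
rewrite mxE sum_vidx dotE; apply: eq_bigr => i _; apply: eq_bigr => j _.
by rewrite mxE !vecE.
Qed.

Lemma dot_mul m n m' n' (P : 'M[R]_(m', m)) (A : 'M[R]_(m, n))
    (Q : 'M[R]_(n, n')) W :
  dot (P *m A *m Q) W = dot A (P^T *m W *m Q^T).
Proof. by rewrite /dot !trmx_mul -!mulmxA mxtrace_mulC !mulmxA. Qed.

Lemma dotDr m n (V W W' : 'M[R]_(m, n)) : dot V (W + W') = dot V W + dot V W'.
Proof. by rewrite /dot mulmxDr linearD. Qed.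

Lemma dotDl m n (V V' W : 'M[R]_(m, n)) : dot (V + V') W = dot V W + dot V' W.
Proof. by rewrite /dot linearD mulmxDl linearD. Qed.

Lemma dotZr m n c (V W : 'M[R]_(m, n)) : dot V (c *: W) = c * dot V W.
Proof. by rewrite /dot -scalemxAr linearZ. Qed.

Lemma dot_delta m n (V : 'M[R]_(m, n)) i j : dot V (delta_mx i j) = V i j.
Proof.
rewrite dotE (bigD1 i) //= (bigD1 j) //= mxE !eqxx mulr1 !big1 ?addr0 //.
  by move=> k ki; rewrite big1 // => l _; rewrite mxE (negPf ki) mulr0.
by move=> l lj; rewrite mxE (negPf lj) andbF mulr0.
Qed.

Lemma bilDl m n (X : 'M[R]_(n * m)) (V V' W : 'M[R]_(m, n)) :
  bil X (V + V') W = bil X V W + bil X V' W.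
Proof. by rewrite /bil vecD linearD /= !mulmxDl mxE. Qed.

Lemma bilDr m n (X : 'M[R]_(n * m)) (V W W' : 'M[R]_(m, n)) :
  bil X V (W + W') = bil X V W + bil X V W'.
Proof. by rewrite /bil vecD !mulmxDr mxE. Qed.

Lemma bilZl m n (X : 'M[R]_(n * m)) c (V W : 'M[R]_(m, n)) :
  bil X (c *: V) W = c * bil X V W.
Proof. by rewrite /bil vecZ linearZ /= -!scalemxAl mxE. Qed.

Lemma bilZr m n (X : 'M[R]_(n * m)) c (V W : 'M[R]_(m, n)) :
  bil X V (c *: W) = c * bil X V W.
Proof. by rewrite /bil vecZ -!scalemxAr mxE. Qed.

Lemma bil_add m n (X Y : 'M[R]_(n * m)) (V W : 'M[R]_(m, n)) :
  bil (X + Y) V W = bil X V W + bil Y V W.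
Proof. by rewrite /bil mulmxDr mulmxDl mxE. Qed.

Lemma bilC m n (X : 'M[R]_(n * m)) (V W : 'M[R]_(m, n)) :
  X^T = X -> bil X V W = bil X W V.
Proof.
move=> XT; rewrite /bil -[in LHS]XT -[in LHS](trmxK (vec W)) -!trmx_mul mxE.
by rewrite mulmxA.
Qed.

Lemma bil_delta m n (X : 'M[R]_(n * m)) (i k : 'I_m) (j l : 'I_n) :
  bil X (delta_mx i j) (delta_mx k l) = X (vidx i j) (vidx k l).
Proof. by rewrite /bil !vec_delta trmx_delta -rowE -colE !mxE. Qed.

Lemma bilE m n (X : 'M[R]_(n * m)) (V W : 'M[R]_(m, n)) :
  bil X V W = \sum_i \sum_j \sum_k \sum_l
    V i j * W k l * X (vidx i j) (vidx k l).
Proof.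
rewrite /bil -mulmxA mxE sum_vidx; apply: eq_bigr => i _; apply: eq_bigr => j _.
rewrite mxE vecE mxE sum_vidx mulr_sumr; apply: eq_bigr => k _.
rewrite mulr_sumr; apply: eq_bigr => l _.
by rewrite vecE; ring.
Qed.

(** The working form of feasibility: the block matrix is evaluated at the vectors with head [s] and
    tail [vec W], and the exchange constraint loses its ordering conditions. *)
Lemma sos_feasibleP m n (A : 'M[R]_(m, n)) t (X : 'M[R]_(n * m)) :
  sos_feasible A t X <->
  [/\ X^T = X,
      forall s W, 0 <= t * s ^+ 2 + 2 * s * dot A W + bil X W W,
      forall i j, X (vidx i j) (vidx i j) <= A i j ^+ 2
    & forall (i k : 'I_m) (j l : 'I_n),
        X (vidx i j) (vidx k l) = X (vidx i l) (vidx k j)].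
Proof.
have psdE s (W : 'M[R]_(m, n)) :
    ((col_mx (s%:M : 'M[R]_1) (vec W))^T *m
      block_mx (t%:M : 'M[R]_1) (vec A)^T (vec A) X *m
      col_mx s%:M (vec W)) 0 0
    = t * s ^+ 2 + 2 * s * dot A W + bil X W W.
  rewrite tr_col_mx mul_row_block mul_row_col tr_scalar_mx !mulmxDl !mul_scalar_mx.
  rewrite -!mulmxA !mul_mx_scalar.
  have mxD (M N : 'M[R]_1) : (M + N) 0 0 = M 0 0 + N 0 0 by rewrite mxE.
  have mxZ c (M : 'M[R]_1) : (c *: M) 0 0 = c * M 0 0 by rewrite mxE.
  rewrite -scalemxAr -scalemxAl mulmxA !mxD !mxZ.
  rewrite [t%:M 0 0]mxE eqxx mulr1n -/(bil X W W) !vec_dot.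
  have -> : dot W A = dot A W by rewrite /dot -mxtrace_tr trmx_mul trmxK.
  by ring.
split=> [[XT [_ psd] dg sw]|[XT psd dg sw]].
  split=> //; first by move=> s W; rewrite -psdE.
  have XC a b : X a b = X b a by rewrite -[in LHS]XT mxE.
  (* For [l < j] this is the same equation read backwards, and for [j = l] it is trivial. Symmetry
     of [X] then covers [k < i] and [i = k]. *)
  have sw' (i k : 'I_m) (j l : 'I_n) : (i < k)%N ->
      X (vidx i j) (vidx k l) = X (vidx i l) (vidx k j).
    move=> ik; have [jl|lj|/val_inj -> //] := ssrnat.ltngtP j l; first exact: sw.
    by rewrite [RHS]sw.
  move=> i k j l; have [ik|ki|/val_inj ->] := ssrnat.ltngtP i k; first exact: sw'.
    by rewrite XC sw' // XC.
  exact: XC.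
split=> //; split; first by rewrite tr_block_mx tr_scalar_mx trmxK XT.
move=> x; rewrite -(vsubmxK x); have [W ->] := vec_surj (dsubmx x).
by rewrite [usubmx x]mx11_scalar psdE.
Qed.

(** Swapping [v] and [z] amounts to swapping the summation indices [j] and [l], which the exchange
    constraint allows. This carries that constraint through a pullback. *)
Lemma bil_rank1_swap m n (X : 'M[R]_(n * m)) (u w : 'cV[R]_m) (v z : 'rV[R]_n) :
  (forall (i k : 'I_m) (j l : 'I_n),
     X (vidx i j) (vidx k l) = X (vidx i l) (vidx k j)) ->
  bil X (u *m v) (w *m z) = bil X (u *m z) (w *m v).
Proof.
move=> sw; rewrite !bilE; apply: eq_bigr => i _.
rewrite exchange_big [RHS]exchange_big; apply: eq_bigr => k _.
rewrite exchange_big; apply: eq_bigr => j _; apply: eq_bigr => l _.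
by rewrite sw !mxE !big_ord1; ring.
Qed.

(** * Cauchy-Schwarz bounds and pullback of a feasible solution *)

Section Feasible.
Variables (m n : nat) (A : 'M[R]_(m, n)) (t : R) (X : 'M[R]_(n * m)).
Hypothesis fX : sos_feasible A t X.

Lemma bil_ge0 W : 0 <= bil X W W.
Proof.
have /sos_feasibleP[_ psd _ _] := fX; have := psd 0 W.
by rewrite expr0n /= !mulr0 mul0r !add0r.
Qed.

Lemma bil_line V W s :
  0 <= s ^+ 2 * bil X V V + 2 * s * bil X V W + bil X W W.
Proof.
have /sos_feasibleP[XT _ _ _] := fX; have := bil_ge0 (s *: V + W).
rewrite bilDl !bilDr !bilZl !bilZr (bilC W V XT).
by congr (_ <= _); ring.
Qed.

Lemma bil_null V W : bil X V V <= 0 -> bil X V W = 0.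
Proof.
move=> VV; apply/eqP/negPn/negP => VW.
(* This parameter makes the linear term cancel [bil X W W] and leave -1, while the quadratic term is
   at most 0. *)
have := bil_line V W (- (bil X W W + 1) / (2 * bil X V W)).
set s := _ / _; have -> : 2 * s * bil X V W = - (bil X W W + 1).
  by rewrite /s; field.
by have := sqr_ge0 s; nra.
Qed.

(** Cauchy-Schwarz with the norms replaced by upper bounds, which avoids square roots. If [x] or [y]
    vanishes, the corresponding vector is null and lies in the radical. *)
Lemma bil_le V W x y : 0 <= x -> 0 <= y ->
  bil X V V <= x ^+ 2 -> bil X W W <= y ^+ 2 -> bil X V W <= x * y.
Proof.
have /sos_feasibleP[XT _ _ _] := fX; move=> x0 y0 VV WW.
have [xE|xN] := eqVneq x 0.
  by rewrite bil_null ?mulr_ge0 // (le_trans VV) // xE expr0n.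
have [yE|yN] := eqVneq y 0.
  by rewrite bilC // bil_null ?mulr_ge0 // (le_trans WW) // yE expr0n.
have xy : 0 < x * y by rewrite mulr_gt0 // lt_def ?xN ?yN.
rewrite -(ler_pM2l xy).
(* Expanding gives [2xy X(V, W) <= y^2 X(V, V) + x^2 X(W, W) <= 2 x^2 y^2]. *)
have := bil_ge0 (y *: V + (- x) *: W).
rewrite bilDl !bilDr !bilZl !bilZr (bilC W V XT) => h.
have hV : y ^+ 2 * bil X V V <= y ^+ 2 * x ^+ 2 by rewrite ler_wpM2l ?sqr_ge0.
have hW : x ^+ 2 * bil X W W <= x ^+ 2 * y ^+ 2 by rewrite ler_wpM2l ?sqr_ge0.
by lra.
Qed.

(** The diagonal constraint and Cauchy-Schwarz on unit matrices bound each entry of [X] at [ij],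
    [kl] by [A i j * A k l]; sum with the nonnegative weights [V i j * W k l]. *)
Lemma bil_le_dot V W : mxle 0 A -> mxle 0 V -> mxle 0 W ->
  bil X V W <= dot A V * dot A W.
Proof.
have /sos_feasibleP[_ _ dg _] := fX.
move=> /mxle0P A0 /mxle0P V0 /mxle0P W0; rewrite bilE !dotE mulr_suml.
apply: ler_sum => i _; rewrite mulr_suml; apply: ler_sum => j _.
rewrite mulr_sumr; apply: ler_sum => k _; rewrite mulr_sumr; apply: ler_sum => l _.
rewrite mulrACA mulrC ler_wpM2r ?mulr_ge0 //.
by rewrite -bil_delta; apply: bil_le => //; rewrite bil_delta.
Qed.

(** By homogeneity, positivity need only be tested at [s = 1] and [s = 0]: for other [s], apply the
    hypothesis to [W / s] and multiply by [s ^+ 2]. Thus [X] may be kept while [t] is lowered to the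
    supremum of the left-hand sides. *)
Lemma feasible_shrink t' :
  (forall W, - (2 * dot A W) - bil X W W <= t') -> sos_feasible A t' X.
Proof.
move=> tP; have /sos_feasibleP[XT _ dg sw] := fX.
apply/sos_feasibleP; split=> // s W; have [->|s0] := eqVneq s 0.
  by rewrite expr0n /= !mulr0 mul0r !add0r bil_ge0.
have := tP (s^-1 *: W); rewrite dotZr bilZl bilZr => h.
have : 0 <= s ^+ 2 * (t' - (- (2 * (s^-1 * dot A W)) - s^-1 * (s^-1 * bil X W W))).
  by rewrite mulr_ge0 ?sqr_ge0 // subr_ge0.
by congr (_ <= _); field.
Qed.

Lemma feasible_pullback m' n' (P : 'M[R]_(m', m)) (Q : 'M[R]_(n, n')) :
  mxle 0 P -> mxle 0 A -> mxle 0 Q ->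
  exists2 Y, sos_feasible (P *m A *m Q) t Y &
    forall V W, bil Y V W = bil X (P^T *m V *m Q^T) (P^T *m W *m Q^T).
Proof.
have /sos_feasibleP[XT psd _ sw] := fX; move=> P0 A0 Q0.
(* [K] is the matrix of [W |-> P^T W Q^T] in [vec] coordinates. Since [vec] reads the transpose, the
   map encoded is [W^T |-> Q W^T P]. *)
pose K := (lin_mx (mulmxr P \o mulmx Q))^T.
have vecK W : vec (P^T *m W *m Q^T) = K *m vec W.
  rewrite /vec /K -trmx_mul mul_vec_lin /= !trmx_mul !trmxK.
  by rewrite mulmxA.
pose Y := K^T *m X *m K.
have YE V W : bil Y V W = bil X (P^T *m V *m Q^T) (P^T *m W *m Q^T).
  by rewrite /bil !vecK trmx_mul !mulmxA.
(* Unit matrices pull back to rank-one products, so [bil_rank1_swap] applies to them. *)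
have deltaE i j : P^T *m delta_mx i j *m Q^T = (row i P)^T *m (col j Q)^T.
  rewrite -(mul_delta_mx (0 : 'I_1) i j) mulmxA -mulmxA; congr (_ *m _).
    by rewrite -(trmx_delta _ 0 i) -trmx_mul -rowE.
  by rewrite -(trmx_delta _ j 0) -trmx_mul -colE.
exists Y => //; apply/sos_feasibleP; split.
- by rewrite /Y !trmx_mul trmxK XT mulmxA.
- by move=> s W; rewrite dot_mul YE.
(* The pulled-back unit matrix is nonnegative and its inner product with [A] is the [ij] entry of
   [P *m A *m Q]. *)
- move=> i j; rewrite -bil_delta YE -[X in _ <= X ^+ 2]dot_delta dot_mul expr2.
  suff d0 : mxle 0 (P^T *m delta_mx i j *m Q^T) by apply: bil_le_dot.
  do 2?apply: mulmx_ge0; do 1?exact: mxle0_tr.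
  by apply/mxle0P => a b; rewrite mxE ler0n.
- move=> i k j l; rewrite -!bil_delta !YE !deltaE.
  exact: bil_rank1_swap.
Qed.

End Feasible.

Lemma tau_sos_le m n (A : 'M[R]_(m, n)) t X : sos_feasible A t X -> tau_sos A <= t.
Proof.
by move=> fX; apply: ge_inf; [case: (sos_values_has_inf A)|exists X].
Qed.

Lemma le_tau_sos m n (A : 'M[R]_(m, n)) c :
  (forall t X, sos_feasible A t X -> c <= t) -> c <= tau_sos A.
Proof.
move=> cP; apply: lb_le_inf; first by case: (sos_values_has_inf A).
by move=> t [X]; apply: cP.
Qed.

Lemma tau_sos_mul m n m' n' (P : 'M[R]_(m', m)) (A : 'M[R]_(m, n))
    (Q : 'M[R]_(n, n')) :
  mxle 0 P -> mxle 0 A -> mxle 0 Q -> tau_sos (P *m A *m Q) <= tau_sos A.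
Proof.
move=> P0 A0 Q0; apply: le_tau_sos => t X fX.
by have [Y fY _] := feasible_pullback fX P0 A0 Q0; exact: tau_sos_le fY.
Qed.

(** Feasible solutions add up; the diagonal constraint survives because [a^2 + b^2 <= (a + b)^2] for
    nonnegative [a] and [b]. *)
Lemma tau_sos_add m n (A B : 'M[R]_(m, n)) :
  mxle 0 A -> mxle 0 B -> tau_sos (A + B) <= tau_sos A + tau_sos B.
Proof.
move=> /mxle0P A0 /mxle0P B0.
rewrite -lerBlDr; apply: le_tau_sos => t X /sos_feasibleP[XT Xp Xd Xs].
rewrite lerBlDr -lerBlDl; apply: le_tau_sos => r Y /sos_feasibleP[YT Yp Yd Ys].
rewrite lerBlDl; apply: (tau_sos_le (X := X + Y)); apply/sos_feasibleP; split.
- by rewrite linearD /= XT YT.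
- move=> s W; have := addr_ge0 (Xp s W) (Yp s W).
  by rewrite dotDl bil_add; congr (_ <= _); ring.
- move=> i j; rewrite !mxE; have := Xd i j; have := Yd i j.
  by have := A0 i j; have := B0 i j; nra.
- by move=> i k j l; rewrite !mxE Xs Ys.
Qed.

End TauSos.

(** * Direct sums *)

Section Block.
Variables (R : realType) (m n m' n' : nat).

(** Multiplying by these selectors extracts a diagonal block, and by their transposes embeds one, so
    the bounds for two-sided products cover both operations. *)
Definition ulrow : 'M[R]_(m, m + m') := row_mx 1%:M 0.
Definition ulcol : 'M[R]_(n + n', n) := col_mx 1%:M 0.
Definition drrow : 'M[R]_(m', m + m') := row_mx 0 1%:M.
Definition drcol : 'M[R]_(n + n', n') := col_mx 0 1%:M.

Lemma mul_ul (S : 'M[R]_(m + m', n + n')) : ulrow *m S *m ulcol = ulsubmx S.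
Proof.
rewrite -[in LHS](submxK S) mul_row_block mul_row_col.
by rewrite !mul1mx !mul0mx !mulmx1 !mulmx0 !addr0.
Qed.

Lemma mul_dr (S : 'M[R]_(m + m', n + n')) : drrow *m S *m drcol = drsubmx S.
Proof.
rewrite -[in LHS](submxK S) mul_row_block mul_row_col.
by rewrite !mul1mx !mul0mx !mulmx1 !mulmx0 !add0r.
Qed.

Lemma mul_tr_ul (V : 'M[R]_(m, n)) : ulrow^T *m V *m ulcol^T = block_mx V 0 0 0.
Proof.
rewrite tr_row_mx tr_col_mx !trmx1 !trmx0 mul_col_mx mul_col_row.
by rewrite mul1mx !mul0mx mulmx1 mulmx0.
Qed.

Lemma mul_tr_dr (V : 'M[R]_(m', n')) : drrow^T *m V *m drcol^T = block_mx 0 0 0 V.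
Proof.
rewrite tr_row_mx tr_col_mx !trmx1 !trmx0 mul_col_mx mul_col_row.
by rewrite mul1mx !mul0mx mulmx1 mulmx0.
Qed.

Lemma block_mx_ge0 (A : 'M[R]_(m, n)) (B : 'M[R]_(m', n')) :
  mxle 0 A -> mxle 0 B -> mxle 0 (block_mx A 0 0 B).
Proof.
move=> A0 B0 i j; rewrite mxE.
case: (split_ordP i) => i' ->; case: (split_ordP j) => j' ->.
- by rewrite block_mxEul; have /mxle0P := A0.
- by rewrite block_mxEur mxE.
- by rewrite block_mxEdl mxE.
- by rewrite block_mxEdr; have /mxle0P := B0.
Qed.

Lemma selectors_ge0 : [/\ mxle 0 ulrow, mxle 0 ulcol, mxle 0 drrow & mxle 0 drcol].
Proof.
split; apply/mxle0P => i j; rewrite mxE; case: splitP => k _; rewrite mxE ?ler0n //.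
Qed.

Variables (A : 'M[R]_(m, n)) (B : 'M[R]_(m', n')).
Hypotheses (A0 : mxle 0 A) (B0 : mxle 0 B).

Lemma selectors_tr_ge0 :
  [/\ mxle 0 ulrow^T, mxle 0 ulcol^T, mxle 0 drrow^T & mxle 0 drcol^T].
Proof. by have [*] := selectors_ge0; split; exact: mxle0_tr. Qed.

Lemma block_split :
  block_mx A 0 0 B = ulrow^T *m A *m ulcol^T + drrow^T *m B *m drcol^T.
Proof. by rewrite mul_tr_ul mul_tr_dr add_block_mx !addr0 add0r. Qed.

Lemma tau_plus_block_le : tau_plus (block_mx A 0 0 B) <= tau_plus A + tau_plus B.
Proof.
have [P0 Q0 P0' Q0'] := selectors_tr_ge0.
rewrite block_split (le_trans (tau_plus_add _ _)) ?lerD ?tau_plus_mul //;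
  by do 2?apply: mulmx_ge0.
Qed.

Lemma tau_sos_block_le : tau_sos (block_mx A 0 0 B) <= tau_sos A + tau_sos B.
Proof.
have [P0 Q0 P0' Q0'] := selectors_tr_ge0.
rewrite block_split (le_trans (tau_sos_add _ _)) ?lerD ?tau_sos_mul //;
  by do 2?apply: mulmx_ge0.
Qed.

(** In a vanishing minor with one corner in each diagonal block, an off-diagonal corner is squeezed
    to 0; hence the product of the two diagonal-block entries is 0. *)
Lemma atoms_block_ul_dr S : atoms (block_mx A 0 0 B) S ->
  ulsubmx S = 0 \/ drsubmx S = 0.
Proof.
move=> [rS S0 SAB].
have ur i j : S (lshift m' i) (rshift n j) = 0.
  apply/eqP; rewrite eq_le; have /mxle0P -> := S0.
  by have := SAB (lshift m' i) (rshift n j); rewrite block_mxEur mxE => ->.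
have [ul|] := eqVneq (ulsubmx S) 0; first by left.
move=> /matrix0Pn[i [j Sij]]; right; apply/matrixP => k l; rewrite !mxE.
have := rank_le1_minor (lshift m' i) (rshift m k) (lshift n' j) (rshift n l) rS.
rewrite ur mul0r => /eqP; rewrite mulf_eq0 => /orP[|/eqP //].
by move: Sij; rewrite !mxE => /negPf ->.
Qed.

Lemma tau_plus_block_ge : tau_plus A + tau_plus B <= tau_plus (block_mx A 0 0 B).
Proof.
have [L [LA <-]] := tau_plus_attained A0.
have [L' [LB <-]] := tau_plus_attained B0.
pose M : {scalar 'M[R]_(m + m', n + n')} :=
  pullback ulrow ulcol L \+ pullback drrow drcol L'.
have ME S : M S = L (ulsubmx S) + L' (drsubmx S).
  by rewrite /M /= mul_ul mul_dr.
have := tau_plus_ub (L := M) (block_mx_ge0 A0 B0).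
rewrite ME block_mxKul block_mxKdr; apply=> S SAB; rewrite ME.
have [ul dr] : atoms A (ulsubmx S) /\ atoms B (drsubmx S).
  have [P0 Q0 P0' Q0'] := selectors_ge0; split.
    have := atoms_mul P0 Q0 SAB; by rewrite !mul_ul block_mxKul.
  have := atoms_mul P0' Q0' SAB; by rewrite !mul_dr block_mxKdr.
(* Only one of the two functionals sees the atom, so the bound 1 is not doubled. *)
have [->|->] := atoms_block_ul_dr SAB; rewrite linear0 ?add0r ?addr0; first exact: LB.
exact: LA.
Qed.

Lemma feasible_block_orth t X V W : sos_feasible (block_mx A 0 0 B) t X ->
  bil X (block_mx V 0 0 0) (block_mx 0 0 0 W) = 0.
Proof.
move=> fX; have /sos_feasibleP[_ _ dg sw] := fX.
have z p q a b : (0 : 'M[R]_(p, q)) a b = 0 by rewrite mxE.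
rewrite bilE; apply: big1 => i _; apply: big1 => j _; apply: big1 => k _.
apply: big1 => l _.
case: (split_ordP i) => i' ->; case: (split_ordP j) => j' ->;
  rewrite ?block_mxEul ?block_mxEur ?block_mxEdl ?block_mxEdr ?z ?mul0r //.
case: (split_ordP k) => k' ->; case: (split_ordP l) => l' ->;
  rewrite ?block_mxEul ?block_mxEur ?block_mxEdl ?block_mxEdr ?z ?mulr0 ?mul0r //.
(* After the exchange, the first index pair lies in the upper right block, where the diagonal
   constraint makes the unit matrix null for [X]. *)
rewrite sw -bil_delta (bil_null fX) ?mulr0 // bil_delta (le_trans (dg _ _)) //.
by rewrite block_mxEur mxE expr0n.
Qed.

Lemma tau_sos_block_ge : tau_sos A + tau_sos B <= tau_sos (block_mx A 0 0 B).
Proof.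
apply: le_tau_sos => t X fX; have AB0 := block_mx_ge0 A0 B0.
have [P0 Q0 P0' Q0'] := selectors_ge0.
have [Y fY YE] := feasible_pullback fX P0 AB0 Q0.
have [Z fZ ZE] := feasible_pullback fX P0' AB0 Q0'.
rewrite mul_ul block_mxKul in fY; rewrite mul_dr block_mxKdr in fZ.
(* Positivity at [s = 1] on a block-diagonal matrix; the cross terms vanish by orthogonality. *)
have key V W : - (2 * dot A V) - bil Y V V + (- (2 * dot B W) - bil Z W W) <= t.
  have /sos_feasibleP[XT psd _ _] := fX.
  have := psd 1 (block_mx V 0 0 0 + block_mx 0 0 0 W).
  rewrite bilDl !bilDr (feasible_block_orth _ _ fX).
  rewrite (bilC (block_mx 0 0 0 W) (block_mx V 0 0 0) XT) (feasible_block_orth _ _ fX).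
  rewrite dotDr -mul_tr_ul -mul_tr_dr -!dot_mul mul_ul mul_dr block_mxKul block_mxKdr.
  by rewrite -YE -ZE; lra.
pose T := [set z | exists V, z = - (2 * dot A V) - bil Y V V]%classic.
have T0 : (T !=set0)%classic by exists (- (2 * dot A 0) - bil Y 0 0), 0.
have leT V : - (2 * dot A V) - bil Y V V <= sup T.
  apply: ub_le_sup; last by exists V.
  (* The upper bound on [T] is [key] at [W = 0]. *)
  exists (t - (- (2 * dot B 0) - bil Z 0 0)) => _ [U ->].
  by rewrite lerBrDr.
have Tle W : - (2 * dot B W) - bil Z W W <= t - sup T.
  rewrite lerBrDl -lerBrDr; apply: ge_sup => // _ [V ->].
  by rewrite lerBrDr.
have := lerD (tau_sos_le (feasible_shrink fY leT)) (tau_sos_le (feasible_shrink fZ Tle)).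
by rewrite addrCA subrr addr0.
Qed.

End Block.

(** * Invariance under nonnegatively invertible transformations *)

Section Equivalence.
Variables (R : realType) (m n : nat) (A : 'M[R]_(m, n)).
Hypothesis A0 : mxle 0 A.

(** Each of [A] and [P *m A *m Q] is a nonnegative two-sided multiple of the other, so the
    inequality holds both ways. *)
Lemma tau_mul_unit (P P' : 'M[R]_m) (Q Q' : 'M[R]_n) :
  mxle 0 P -> mxle 0 P' -> mxle 0 Q -> mxle 0 Q' ->
  P' *m P = 1%:M -> Q *m Q' = 1%:M ->
  tau_plus (P *m A *m Q) = tau_plus A /\ tau_sos (P *m A *m Q) = tau_sos A.
Proof.
move=> P0 P0' Q0 Q0' PP QQ; set B := P *m A *m Q.
have B0 : mxle 0 B by do 2?apply: mulmx_ge0.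
have AE : A = P' *m B *m Q' by rewrite /B !mulmxA PP mul1mx -mulmxA QQ mulmx1.
split; apply/eqP; rewrite eq_le.
  by rewrite tau_plus_mul //= [X in tau_plus X <= _]AE tau_plus_mul.
by rewrite tau_sos_mul //= [X in tau_sos X <= _]AE tau_sos_mul.
Qed.

End Equivalence.

(** * The six properties together *)

Theorem theorem3 (R : realType) (m n : nat) (A : 'M[R]_(m, n))
    (A_ge0 : mxle 0 A) :
  (* invariance under diagonal scaling *)
  (forall (D1 : 'M[R]_m) (D2 : 'M[R]_n),
     is_diag_mx D1 -> is_diag_mx D2 ->
     (forall i, 0 < D1 i i) -> (forall j, 0 < D2 j j) ->
     tau_plus (D1 *m A *m D2) = tau_plus A /\
     tau_sos (D1 *m A *m D2) = tau_sos A) /\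
  (* invariance under permutation of rows or columns *)
  (forall (P1 : 'M[R]_m) (P2 : 'M[R]_n),
     is_perm_mx P1 -> is_perm_mx P2 ->
     tau_plus (P1 *m A *m P2) = tau_plus A /\
     tau_sos (P1 *m A *m P2) = tau_sos A) /\
  (* subadditivity *)
  (forall B : 'M[R]_(m, n), mxle 0 B ->
     tau_plus (A + B) <= tau_plus A + tau_plus B /\
     tau_sos (A + B) <= tau_sos A + tau_sos B) /\
  (* product *)
  (forall (p : nat) (B : 'M[R]_(n, p)), mxle 0 B ->
     tau_plus (A *m B) <= Num.min (tau_plus A) (tau_plus B) /\
     tau_sos (A *m B) <= Num.min (tau_sos A) (tau_sos B)) /\
  (* monotonicity *)
  (forall (I : {set 'I_m}) (J : {set 'I_n}),
     tau_plus (submatrix A I J) <= tau_plus A /\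
     tau_sos (submatrix A I J) <= tau_sos A) /\
  (* block-diagonal composition *)
  (forall (m' n' : nat) (B : 'M[R]_(m', n')), mxle 0 B ->
     tau_plus (block_mx A 0 0 B) = tau_plus A + tau_plus B /\
     tau_sos (block_mx A 0 0 B) = tau_sos A + tau_sos B).
Proof.
have ge1 := @mxle0_1 R.
split=> [D1 D2 /diag_mx_pos_inv + /diag_mx_pos_inv + p1 p2|].
  move=> /(_ p1)[D10 [E1 E10 [ED1 _]]] /(_ p2)[D20 [E2 E20 [_ DE2]]].
  exact: tau_mul_unit ED1 DE2.
split=> [P1 P2 /existsP[s /eqP ->] /existsP[s' /eqP ->]|].
  apply: (tau_mul_unit A_ge0 (P' := perm_mx s^-1%g) (Q' := perm_mx s'^-1%g));
    try exact: perm_mx_ge0.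
    by rewrite -perm_mxM mulVg perm_mx1.
  by rewrite -perm_mxM mulgV perm_mx1.
split=> [B B0|]; first by rewrite tau_plus_add ?tau_sos_add.
split=> [p B B0|].
  (* Read the product as [1 A B] to bound it by [A], and as [A B 1] to bound it by [B]. *)
  have tp : tau_plus (A *m B) <= tau_plus A by rewrite -[X in X *m B]mul1mx tau_plus_mul.
  have ts : tau_sos (A *m B) <= tau_sos A by rewrite -[X in X *m B]mul1mx tau_sos_mul.
  have [tp' ts'] : tau_plus (A *m B) <= tau_plus B /\ tau_sos (A *m B) <= tau_sos B.
    rewrite -(mulmx1 (A *m B)); split; [exact: tau_plus_mul|exact: tau_sos_mul].
  by rewrite !le_min tp tp' ts ts'.
split=> [I J|m' n' B B0]; last first.
  by split; apply/eqP; rewrite eq_le ?tau_plus_block_le ?tau_plus_block_ge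
    ?tau_sos_block_le ?tau_sos_block_ge.
have -> : submatrix A I J = rowsub enum_val 1%:M *m A *m colsub enum_val 1%:M.
  rewrite mul_rowsub_mx mul1mx mulmx_colsub mulmx1.
  by apply/matrixP => i j; rewrite !mxE.
have sub0 p q r (f : 'I_p -> 'I_q) (g : 'I_r -> 'I_q) : mxle 0 (mxsub f g (1%:M : 'M[R]_q)).
  by apply/mxle0P => i j; rewrite !mxE ler0n.
by rewrite tau_plus_mul ?tau_sos_mul.
Qed.
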